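(* There exists an open and dense set $U\subseteq(0,1)$ such that $\#T(\alpha)>0$ for all $\alpha\in U$.
   Context: $\mathbb{N}$ is the set of positive integers; $\lfloor x\rfloor$ is the integer part (floor) of $x$. For $X\subseteq\mathbb{N}$, $T(X)$ is the set of all tuples $(k,\ell,m)\in\mathbb{N}^3$ with $k\leq \ell\leq m$ such that all of $k,\ \ell,\ m,\ k+\ell,\ \ell+m,\ m+k,\ k+\ell+m$ belong to $X$. For $\alpha>0$, let $S(\alpha)=\{\lfloor \alpha n^2\rfloor : n\in\mathbb{N},\ n\geq \alpha^{-1/2}\}$ and $T(\alpha)=T(S(\alpha))$. *)

(* Defs.v *)
From mathcomp Require Import all_boot all_order all_algebra.
From mathcomp Require Import all_classical all_reals all_analysis.

Set Implicit Arguments.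
Unset Strict Implicit.
Unset Printing Implicit Defensive.

Import Order.TTheory GRing.Theory Num.Theory.
Import numFieldNormedType.Exports.

Local Open Scope classical_set_scope.
Local Open Scope ring_scope.

(* Sets of positive integers are rendered as [set nat]; the condition [0 < k]
   (hence also [0 < l] and [0 < m]) keeps the tuples in positive integers
   whatever [X] is. *)
Definition sum_triples (X : set nat) : set (nat * nat * nat) :=
  [set t | let: (k, l, m) := t in
     [/\ (0 < k)%N, (k <= l)%N & (l <= m)%N] /\
     [/\ X k, X l & X m] /\
     [/\ X (k + l)%N, X (l + m)%N & X (m + k)%N] /\
     X (k + l + m)%N].

Definition floor_squares (R : realType) (alpha : R) : set nat :=
  [set x | exists n : nat,
     [/\ (0 < n)%N, alpha `^ (- 2^-1) <= n%:R
       & x%:Z = Num.floor (alpha * n%:R ^+ 2)]].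

(* Main.v *)
(* If [8 p^2 + 1 = u^2], put [Y = p^2] and [X = (2 p)^2 = 4 Y].  Then
   [u^2 = 2 X + 1], [(2 Y)^2 = X Y], and [(2 Y -+ 1)^2 = X (Y -+ 1) + 1].  For
   [alpha = m / X] with [0 < m < X] the correction terms contribute only
   [alpha < 1], so the floors of [alpha n^2] at [n = 2 p], [u], [2 Y - 1], [2 Y],
   [2 Y + 1] are [m], [2 m], [m (Y - 1)], [m Y], [m (Y + 1)], and
   [(m, m, m (Y - 1))] is a triple of the required kind.  These floors are
   unchanged when [alpha] is increased slightly, and the points [m / X] are
   dense because the Pell equation has arbitrarily large solutions. *)
Require Import Defs.
From mathcomp Require Import all_boot all_order all_algebra.
From mathcomp Require Import all_classical all_reals all_analysis.
From mathcomp Require Import zify ring lra.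

Set Implicit Arguments.
Unset Strict Implicit.
Unset Printing Implicit Defensive.

Import Order.TTheory GRing.Theory Num.Theory.
Import numFieldNormedType.Exports.

Local Open Scope classical_set_scope.
Local Open Scope ring_scope.

(** Multiplying [u + p * sqrt 8] by the unit [3 + sqrt 8] gives the next solution, with a larger
    [p]. The start is [(3 + sqrt 8)^2 = 17 + 6 * sqrt 8], since [3 + sqrt 8] itself has [p = 1]. *)
Lemma pell8_unbounded (N : nat) :
  exists p u : nat, (maxn 1 N < p)%N /\ (u ^ 2 = 8 * p ^ 2 + 1)%N.
Proof.
elim: N => [|N [p [u [ltNp pell]]]]; first by exists 6%N, 17%N.
by exists (u + 3 * p)%N, (3 * u + 8 * p)%N; split; nia.
Qed.

Lemma mem_floor_squares (R : realType) (alpha : R) (n c : nat) :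
  0 < alpha -> (0 < c)%N -> c%:R <= alpha * n%:R ^+ 2 < c%:R + 1 ->
  floor_squares alpha c.
Proof.
move=> a_gt0 c_gt0 /andP[le_c lt_c].
(* This is the side condition [n >= alpha^(-1/2)] in squared form, and it also excludes [n = 0]. *)
have an2_ge1 : 1 <= alpha * n%:R ^+ 2 by apply: le_trans le_c; rewrite ler1n.
exists n; split.
- by case: n an2_ge1 {le_c lt_c} => //; rewrite expr0n mulr0 ler10.
- rewrite powRN (powR12_sqrt (ltW a_gt0)) -[leLHS]mulr1 ler_pdivrMl ?sqrtr_gt0//.
  rewrite -(@ler_pXn2r _ 2) ?nnegrE ?mulr_ge0 ?sqrtr_ge0//.
  by rewrite expr1n exprMn sqr_sqrtr// ltW.
- by apply/esym/floor_def; rewrite intrD -!pmulrn le_c.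
Qed.

(** With [e = alpha X - m], the excess of [alpha n^2] over [m s] is [e s + alpha d]. Multiplied by
    [X] it becomes [e n^2 + m d < 1 + m <= X], so the excess is below 1. *)
Lemma floor_squares_near_fraction (R : realType) (alpha : R) (X m n s d : nat) :
  (0 < m < X)%N -> (0 < s)%N -> (d <= 1)%N -> (n ^ 2 = X * s + d)%N ->
  m%:R < alpha * X%:R -> (alpha * X%:R - m%:R) * n%:R ^+ 2 < 1 ->
  floor_squares alpha (m * s)%N.
Proof.
move=> /andP[m_gt0 ltmX] s_gt0 d_le1 /(congr1 (fun k => k%:R : R)).
rewrite natrX natrD natrM => n2E.
have X_gt0 : 0 < X%:R :> R by rewrite ltr0n (leq_trans _ ltmX).
rewrite -subr_gt0; set e := _ - _ => e_gt0 e_lt.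
have aX : alpha * X%:R = m%:R + e by rewrite /e addrC subrK.
clearbody e.
have a_gt0 : 0 < alpha by rewrite -(pmulr_lgt0 _ X_gt0) aX ltr_wpDl ?ler0n.
have an2 : alpha * n%:R ^+ 2 = (m * s)%:R + (e * s%:R + alpha * d%:R).
  by rewrite n2E mulrDr mulrA aX natrM; ring.
apply: (@mem_floor_squares _ _ n); rewrite ?muln_gt0 ?m_gt0// an2.
rewrite lerDl ltrD2l addr_ge0 ?mulr_ge0 ?(ltW e_gt0) ?(ltW a_gt0)//=.
have d_le : m%:R * d%:R <= m%:R :> R by rewrite ler_piMr// lern1.
have m_le : m%:R + 1 <= X%:R :> R by rewrite natr1 ler_nat.
rewrite -(ltr_pM2r X_gt0) mul1r.
have -> : (e * s%:R + alpha * d%:R) * X%:R = e * n%:R ^+ 2 + m%:R * d%:R.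
  have -> : m%:R = alpha * X%:R - e by rewrite aX addrK.
  by rewrite n2E; ring.
lra.
Qed.

Lemma sum_triples_near_fraction (R : realType) (alpha : R) (p u m : nat) :
  (1 < p)%N -> (u ^ 2 = 8 * p ^ 2 + 1)%N -> (0 < m < 4 * p ^ 2)%N ->
  m%:R < alpha * (4 * p ^ 2)%:R ->
  (alpha * (4 * p ^ 2)%:R - m%:R) * (2 * p ^ 2 + 1)%:R ^+ 2 < 1 ->
  sum_triples (floor_squares alpha) (m, m, m * (p ^ 2).-1)%N.
Proof.
move=> p_gt1 pell m_bnd lt_m e_lt.
(* The bound on the excess is assumed at [2 p^2 + 1], the largest of the five roots, and so covers
   the others. *)
have floorE (n s d : nat) : (0 < s)%N -> (d <= 1)%N -> (n <= 2 * p ^ 2 + 1)%N ->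
    (n ^ 2 = 4 * p ^ 2 * s + d)%N -> floor_squares alpha (m * s)%N.
  move=> s_gt0 d_le1 le_n n2E.
  apply: (floor_squares_near_fraction m_bnd s_gt0 d_le1 n2E lt_m).
  apply: le_lt_trans e_lt; rewrite ler_pM2l ?subr_gt0//.
  by rewrite lerXn2r ?nnegrE ?ler0n// ler_nat.
(* Needed for the multiplier [p^2 - 1] of the third entry to be positive. *)
have Y_gt1 : (1 < p ^ 2)%N by nia.
have k_in : floor_squares alpha m.
  by rewrite -(muln1 m); apply: (floorE (2 * p)%N 1%N 0%N) => //; nia.
have kl_in : floor_squares alpha (m * 2)%N by apply: (floorE u 2%N 1%N) => //; nia.
have m_in : floor_squares alpha (m * (p ^ 2).-1)%N.
  by apply: (floorE (2 * p ^ 2).-1 _ 1%N) => //; nia.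
have lm_in : floor_squares alpha (m * p ^ 2)%N.
  by apply: (floorE (2 * p ^ 2)%N _ 0%N) => //; nia.
have klm_in : floor_squares alpha (m * (p ^ 2).+1)%N.
  by apply: (floorE (2 * p ^ 2 + 1)%N _ 1%N) => //; nia.
have [m_gt0 _] := andP m_bnd.
have lmE : (m + m * (p ^ 2).-1 = m * p ^ 2)%N by nia.
have klmE : (m + m + m * (p ^ 2).-1 = m * (p ^ 2).+1)%N by nia.
rewrite /sum_triples /= klmE (addnC _ m) lmE addnn -muln2.
by do ![split => //]; rewrite leq_pmulr//; lia.
Qed.

Theorem corollary1p3 (R : realType) :
  exists U : set R,
    [/\ open U, U `<=` `]0, 1[, `]0, 1[ `<=` closure U
      & forall alpha : R, U alpha -> sum_triples (floor_squares alpha) !=set0].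
Proof.
pose X p : R := (4 * p ^ 2)%:R.
(* For [alpha] within [w p] above [m / X p], the excess [alpha * X p - m] times [(2 p^2 + 1)^2]
   stays below 1. *)
pose w p : R := (X p * (2 * p ^ 2 + 1)%:R ^+ 2)^-1.
have X_gt0 p : (0 < p)%N -> 0 < X p by move=> p0; rewrite ltr0n; nia.
have w_gt0 p : (0 < p)%N -> 0 < w p.
  by move=> p0; rewrite invr_gt0 mulr_gt0 ?X_gt0// exprn_gt0// ltr0n addn1.
have w_le p : (0 < p)%N -> w p <= (X p)^-1.
  move=> p0; rewrite /w invfM ler_piMr ?invr_ge0 ?ler0n//.
  by rewrite invf_le1 ?exprn_ege1 ?exprn_gt0 ?ltr0n ?ler1n ?addn1.
pose good (i : nat * nat) :=
  [/\ (1 < i.1)%N, exists u, (u ^ 2 = 8 * i.1 ^ 2 + 1)%N & (0 < i.2 < 4 * i.1 ^ 2)%N].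
pose J (i : nat * nat) : set R :=
  `]i.2%:R / X i.1, i.2%:R / X i.1 + w i.1[%classic.
exists (\bigcup_(i in good) J i); split.
- by apply: bigcup_open => i _; exact: interval_open.
- move=> a [[p m] [/= p1 _ /andP[m0 mX]]]; rewrite /J /= !in_itv /= => /andP[lo hi].
  have p0 : (0 < p)%N by exact: ltnW.
  apply/andP; split; first by apply: lt_trans lo; rewrite divr_gt0 ?X_gt0// ltr0n.
  apply: lt_le_trans hi _; apply: le_trans (_ : (m%:R + 1) / X p <= _).
    by rewrite mulrDl mul1r lerD2l w_le.
  by rewrite ler_pdivrMr ?X_gt0// mul1r natr1 ler_nat.
- move=> a; rewrite /= in_itv /= => /andP[a0 a1] B.
  rewrite -nbhs_ballE => -[r /= r0 rB].
  (* Large enough for both [a * X p > 1], which makes the numerator [m] positive, and a mesh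
     [1 / X p] below [r]. *)
  pose N := (Num.truncn (a^-1 + r^-1)).+1.
  have [p [u [ltNp pell]]] := pell8_unbounded N.
  have p1 : (1 < p)%N by lia.
  have p0 : (0 < p)%N by lia.
  have leNp : (N <= p)%N by lia.
  have ltX : a^-1 + r^-1 < X p.
    apply: lt_le_trans (truncnS_gt _) _; rewrite ler_nat.
    by apply: leq_trans leNp _; nia.
  have aX : 1 < a * X p.
    by rewrite -ltr_pdivrMl// mulr1; apply: lt_trans ltX; rewrite ltrDl invr_gt0.
  have rX : (X p)^-1 < r.
    rewrite -[ltRHS]invrK ltf_pV2 ?posrE ?invr_gt0 ?X_gt0//.
    by apply: lt_trans ltX; rewrite ltrDr invr_gt0.
  pose m := Num.truncn (a * X p).
  have /andP[le_m lt_m] := truncn_itv (ltW (lt_trans ltr01 aX)).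
  have wp := w_gt0 _ p0; have wX := w_le _ p0.
  (* The midpoint of [J (p, m)] shares with [a] the cell from [m / X p] to [(m + 1) / X p], of
     length less than [r]. *)
  exists (m%:R / X p + w p / 2); split.
    exists (p, m); first split => //=; first by exists u.
      apply/andP; split; first by rewrite truncn_gt0 ltW.
      by rewrite -(ltr_nat R); apply: le_lt_trans le_m _; rewrite gtr_pMl ?X_gt0.
    by rewrite /J /= in_itv /=; apply/andP; split; lra.
  apply: rB; rewrite /ball /=.
  have lo : m%:R / X p <= a by rewrite ler_pdivrMr ?X_gt0.
  have hi : a < m%:R / X p + (X p)^-1.
    by rewrite -[X in _ + X]mul1r -mulrDl ltr_pdivlMr ?X_gt0// natr1.
  by rewrite ltr_distlC; apply/andP; split; lra.
- move=> a [[p m] [/= p1 [u pell] m_bnd]]; rewrite /J /= in_itv /= => /andP[lo hi].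
  have Xp : 0 < X p by rewrite X_gt0// ltnW.
  exists (m, m, m * (p ^ 2).-1)%N; apply: sum_triples_near_fraction pell m_bnd _ _ => //.
    by rewrite -ltr_pdivrMr.
  have D_gt0 : 0 < (2 * p ^ 2 + 1)%:R ^+ 2 :> R by rewrite exprn_gt0// ltr0n addn1.
  have -> : a * (4 * p ^ 2)%:R - m%:R = (a - m%:R / X p) * X p.
    by rewrite mulrBl divfK ?gt_eqF.
  by rewrite -mulrA -ltr_pdivlMr ?mulr_gt0// mul1r ltrBlDl.
Qed.
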